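(* Let $s\in\Sigma^n$ be primitive, and suppose $BWT_{*}(s)$ is based on a local ordering and supports constant-time rank queries. After an ${\cal O}(\sigma^2)$-time preprocessing, given any string $x=x_1x_2\cdots x_p$, the range $R[x]$ of rows of $M_{*}(s)$ prefixed by $x$ can be computed in ${\cal O}(p)$ time and ${\cal O}(\sigma^2+p)$ space.
   Context: For every string $y$ over $\Sigma$ ($|\Sigma|=\sigma$) let $\pi_y$ be a total order of $\Sigma$. $M_{*}(s)$ is the matrix whose rows (numbered $1,\dots,n$ top to bottom) are the cyclic rotations of $s$ (primitive: all rotations distinct), sorted so that for distinct rotations $u\neq v$ with longest common prefix $y$ and next symbols $a$ (in $u$) and $b$ (in $v$), $u$ precedes $v$ iff $a$ precedes $b$ in $\pi_y$; $BWT_{*}(s)=L$ is its last column. Local ordering: there are orders $\pi_\epsilon$ and $\pi_c$ ($c\in\Sigma$) with $\pi_y=\pi_\epsilon$ for empty $y$ and $\pi_y=\pi_c$ if $y$ is nonempty ending with $c$. $R[x]=[b_x,\ell_x]$ means row $j$ is prefixed by $x$ iff $b_x\le j<b_x+\ell_x$ ($[0,0]$ if none). Constant-time rank: $\mathsf{rank}_c(L,j)$ (number of $c$'s in $L[1,j]$) in ${\cal O}(1)$ time. Model: word RAM with word size $w$, $\sigma=w^{{\cal O}(1)}$. *)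

(* Defs.v *)
From mathcomp Require Import all_boot.

Set Implicit Arguments.
Unset Strict Implicit.
Unset Printing Implicit Defensive.

Section Transform.
Variable T : eqType.
Implicit Types (s u v x y : seq T) (M : seq (seq T)) (pi : seq T -> rel T).

Definition rotations s := [seq rot i s | i <- iota 0 (size s)].

Definition primitive_string s := (0 < size s) && uniq (rotations s).

Definition total_order (r : rel T) :=
  [/\ reflexive r, antisymmetric r, transitive r & total r].

Fixpoint lcp u v : seq T :=
  match u, v with
  | a :: u', b :: v' => if a == b then a :: lcp u' v' else [::]
  | _, _ => [::]
  end.

(* The orders are given in their reflexive form, hence the test a != b.       *)
Definition precedes pi u v : bool :=
  let y := lcp u v in
  match drop (size y) u, drop (size y) v with
  | a :: _, b :: _ => (a != b) && pi y a b
  | _, _ => false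
  end.

Definition Mstar pi s : seq (seq T) :=
  sort (fun u v => (u == v) || precedes pi u v) (rotations s).

(* Rows are nonempty as soon as s is, so pmap drops nothing.                  *)
Definition BWTstar pi s : seq T :=
  pmap (fun u => ohead (rev u)) (Mstar pi s).

Definition local_ordering pi (pi_eps : rel T) (pi_sym : T -> rel T) :=
  (pi [::] =2 pi_eps) /\ (forall y c, pi (rcons y c) =2 pi_sym c).

(* Rows are numbered from 1.                                                  *)
Definition is_range M x (b l : nat) : Prop :=
  if has (prefix x) M then
    forall j, (0 < j <= size M) && prefix x (nth [::] M j.-1) = (b <= j < b + l)
  else b = 0 /\ l = 0.

End Transform.

(* Word RAM: registers and memory cells hold naturals below 2 ^ w, addresses  *)
(* are words, and a program is a fixed finite list of unit-cost instructions. *)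
(* A run has a read-only input array and a unit-cost rank oracle.             *)
Inductive binop :=
  Add | Sub | Mul | Div | Mod | And | Or | Xor | Shl | Shr.

Inductive instr :=
  | Const of nat & nat          (* r := k                              *)
  | Move of nat & nat           (* r := r1                             *)
  | Op of binop & nat & nat & nat (* r := r1 op r2                     *)
  | ReadMem of nat & nat        (* r := memory[r1]                     *)
  | WriteMem of nat & nat       (* memory[r1] := r2                    *)
  | ReadInput of nat & nat      (* r := input[r1], 0 past the end      *)
  | Rank of nat & nat & nat     (* r := rank_{r1}(L, r2)               *)
  | Jump of nat
  | JumpEq of nat & nat & nat   (* if r1 = r2 goto k                   *)
  | JumpLt of nat & nat & nat.  (* if r1 < r2 goto k                   *)

Definition program := seq instr.

(* top is one more than the largest memory address accessed so far.           *)
Record config := Config {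
  pc : nat; regs : nat -> nat; memory : nat -> nat; top : nat }.

Definition upd (f : nat -> nat) (i v : nat) : nat -> nat :=
  fun j => if j == i then v else f j.

Section Machine.
Variables (w : nat) (inp : seq nat) (rk : nat -> nat -> nat).

Definition wrap (k : nat) : nat := k %% 2 ^ w.

Definition eval_op (o : binop) (a b : nat) : nat :=
  wrap match o with
  | Add => a + b
  | Sub => a + 2 ^ w - b
  | Mul => a * b
  | Div => a %/ b
  | Mod => a %% b
  | And => Nat.land a b
  | Or  => Nat.lor a b
  | Xor => Nat.lxor a b
  | Shl => a * 2 ^ b
  | Shr => a %/ 2 ^ b
  end.

Definition exec (i : instr) (cf : config) : config :=
  let: Config p r m t := cf in
  match i with
  | Const d k => Config p.+1 (upd r d (wrap k)) m t
  | Move d a => Config p.+1 (upd r d (r a)) m t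
  | Op o d a b => Config p.+1 (upd r d (eval_op o (r a) (r b))) m t
  | ReadMem d a => Config p.+1 (upd r d (m (r a))) m (maxn t (r a).+1)
  | WriteMem a b => Config p.+1 r (upd m (r a) (r b)) (maxn t (r a).+1)
  | ReadInput d a => Config p.+1 (upd r d (nth 0 inp (r a))) m t
  | Rank d a b => Config p.+1 (upd r d (rk (r a) (r b))) m t
  | Jump k => Config k r m t
  | JumpEq a b k => Config (if r a == r b then k else p.+1) r m t
  | JumpLt a b k => Config (if r a < r b then k else p.+1) r m t
  end.

Variable P : program.

Definition halted (cf : config) : bool := size P <= pc cf.

(* A halted configuration is a fixed point, so being halted after t steps     *)
(* means that the running time is at most t.                                  *)
Definition step (cf : config) : config :=
  if onth P (pc cf) is Some i then exec i cf else cf.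

Definition run (t : nat) (cf : config) : config := iter t step cf.

End Machine.

(* The first registers hold the listed arguments, the others 0.               *)
Definition start (args : seq nat) (m : nat -> nat) (t : nat) : config :=
  Config 0 (nth 0 args) m t.

Section Encoding.
Variable sigma : nat.

Definition code (x : seq 'I_sigma) : seq nat := [seq val a | a <- x].

Definition rank (L : seq 'I_sigma) (c j : nat) : nat :=
  count_mem c (take j (code L)).

Definition increasing_list (r : rel 'I_sigma) : seq 'I_sigma :=
  sort r (enum 'I_sigma).

(* Entry i is the i-th symbol for pi_eps; entry sigma * c.+1 + i is the i-th  *)
(* symbol for pi_sym c (everything counted from 0).                           *)
Definition order_table (pi_eps : rel 'I_sigma)
    (pi_sym : 'I_sigma -> rel 'I_sigma) : seq nat :=
  code (increasing_list pi_eps ++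
        flatten [seq increasing_list (pi_sym c) | c <- enum 'I_sigma]).

(* Starting from memory m, whose first t cells hold the data structure, the   *)
(* queries xs are answered one after the other, each in the memory left by    *)
(* the previous one. The space of a query comprises the data structure, the   *)
(* working memory and the size x words of the input.                          *)
Fixpoint answers (w n : nat) (M : seq (seq 'I_sigma)) (L : seq 'I_sigma)
    (query : program) (C t : nat) (m : nat -> nat)
    (xs : seq (seq 'I_sigma)) : Prop :=
  if xs is x :: xs' then
    let cf := run w (code x) (rank L) query (C * maxn 1 (size x))
                (start [:: n; sigma; size x] m t) in
    [/\ halted query cf,
        is_range M x (regs cf 0) (regs cf 1),
        size x + top cf <= C * (sigma ^ 2 + size x) &
        answers w n M L query C t (memory cf) xs']
  else True.

End Encoding.

(* Main.v *)
(* Let B x = first_row x be the number of rows of M preceding all extensions  *)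
(* of x, and l x = num_rows x the number of rows prefixed by x, so that R[x]  *)
(* starts at row B x + 1. Rotating a row of R[x] that ends with c by one      *)
(* position to the right gives a row of R[c x]; as the order of two rows      *)
(* sharing a nonempty prefix only depends on the last symbol of their common  *)
(* prefix, this rotation is order preserving on the rows with a common first  *)
(* symbol a. Hence                                                            *)
(*   l (c x) = rank_c (B x + l x) - rank_c (B x),                             *)
(*   B (c a x) - B (c a) = rank_c (B (a x)) - rank_c (B a),                   *)
(* so x can be scanned backwards with two rank queries per symbol once the    *)
(* constants B (c a) - rank_c (B a) are tabulated. The latter only need sums  *)
(* of l a and l (c a) along the orders pi_eps and pi_c. None of this requires *)
(* l x to be nonzero, but it does require strings of size at most n.          *)
Require Import Defs.
From mathcomp Require Import all_boot.
From mathcomp Require Import zify.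

Set Implicit Arguments.
Unset Strict Implicit.
Unset Printing Implicit Defensive.

Arguments eval_op : simpl never.
Arguments upd f i v j /.

Section WordArithmetic.
Variable w : nat.
Implicit Types a b c d : nat.

Lemma wrap_small a : a < 2 ^ w -> Defs.wrap w a = a.
Proof. exact: modn_small. Qed.

Lemma add_small a b : a + b < 2 ^ w -> eval_op w Add a b = a + b.
Proof. exact: wrap_small. Qed.

Lemma mul_small a b : a * b < 2 ^ w -> eval_op w Mul a b = a * b.
Proof. exact: wrap_small. Qed.

Lemma add_sub_wrap a b c d :
  a + c = b + d -> b <= 2 ^ w -> d < 2 ^ w ->
  eval_op w Add (eval_op w Defs.Sub a b) c = d.
Proof.
move=> eq_sum le_b lt_d; rewrite /eval_op /Defs.wrap modnDml.
have -> : a + 2 ^ w - b + c = d + 2 ^ w by lia.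
by rewrite modnDr modn_small.
Qed.

Lemma sub_small a b : b <= a < 2 ^ w -> eval_op w Defs.Sub a b = a - b.
Proof.
move=> /andP[le_ba lt_a]; rewrite /eval_op /Defs.wrap -addnBAC // modnDr.
by rewrite modn_small //; lia.
Qed.

End WordArithmetic.

Lemma expn_lt_exp2 K : exists w0, forall w, w0 <= w -> w ^ K < 2 ^ w.
Proof.
exists (K.+1 ^ K.+1).+1 => w lt_w; have w_gt0 : 0 < w by apply: leq_trans lt_w.
suff le_w : w ^ K.+1 <= K.+1 ^ K.+1 * 2 ^ w.
  rewrite -(ltn_pmul2l w_gt0) -expnS (leq_ltn_trans le_w) //.
  by rewrite ltn_pmul2r ?expn_gt0.
set q := w %/ K.+1.
have le_wq : w <= K.+1 * 2 ^ q.
  rewrite (leq_trans (ltnW (ltn_ceil w (ltn0Sn K)))) // mulnC leq_pmul2l //.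
  exact: ltn_expl.
rewrite (leq_trans (_ : _ <= (K.+1 * 2 ^ q) ^ K.+1)) ?leq_exp2r //.
by rewrite expnMn leq_pmul2l ?expn_gt0 // -expnM leq_pexp2l // leq_divM.
Qed.

Lemma sqr_add_lt_exp2 K : exists w0, forall w sigma,
  w0 <= w -> sigma <= w ^ K -> sigma ^ 2 + sigma < 2 ^ w.
Proof.
have [w0 exp_lt] := expn_lt_exp2 (K * 2).+1.
exists (maxn 2 w0) => w sigma; rewrite geq_max => /andP[w_gt1 /exp_lt].
rewrite expnS expnM -mulnn => lt_w le_sigma; apply: leq_ltn_trans lt_w.
by have := leq_mul le_sigma le_sigma; nia.
Qed.

(** * Structured programs *)

Inductive command :=
  | Block of seq instr
  | Then of command & command
  | IfLt of nat & nat & command & command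
  | WhileLt of nat & nat & command.

Declare Scope command_scope.
Delimit Scope command_scope with C.
Bind Scope command_scope with command.
Notation "c1 ;; c2" := (Then c1 c2)
  (at level 61, right associativity, format "c1 ;; '//' c2") : command_scope.

(* The first argument is the address at which the code is placed. *)
Fixpoint compile (p : nat) (c : command) : program :=
  match c with
  | Block code => code
  | Then c1 c2 =>
      let code1 := compile p c1 in code1 ++ compile (p + size code1) c2
  | IfLt a b c1 c2 =>
      let code2 := compile p.+1 c2 in
      let p1 := p.+2 + size code2 in
      let code1 := compile p1 c1 in
      JumpLt a b p1 :: code2 ++ Jump (p1 + size code1) :: code1
  | WhileLt a b c1 =>
      let code1 := compile p.+2 c1 in
      [:: JumpLt a b p.+2, Jump (p.+3 + size code1) & rcons code1 (Jump p)]
  end.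

Definition straight (i : instr) : bool :=
  if i is (Jump _ | JumpEq _ _ _ | JumpLt _ _ _) then false else true.

(* An assertion bears on the registers, the memory and the space used so far. *)
Definition assertion := (nat -> nat) -> (nat -> nat) -> nat -> Prop.

Definition holds (A : assertion) (cf : config) : Prop :=
  A (regs cf) (memory cf) (top cf).

Definition loaded (P : program) (p : nat) (Q : program) : Prop :=
  forall k i, onth Q k = Some i -> onth P (p + k) = Some i.

Lemma loaded0 (Q : program) : loaded Q 0 Q.
Proof. by []. Qed.

Lemma loaded_cons P p i Q :
  loaded P p (i :: Q) -> onth P p = Some i /\ loaded P p.+1 Q.
Proof.
move=> loadP; split=> [|k j Qk].
  by have := loadP 0 i erefl; rewrite addn0.
by have := loadP k.+1 j Qk; rewrite addnS.
Qed.

Lemma loaded_cat P p Q1 Q2 :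
  loaded P p (Q1 ++ Q2) -> loaded P p Q1 /\ loaded P (p + size Q1) Q2.
Proof.
move=> loadP; split=> k i Qk.
  apply: loadP; rewrite onth_cat.
  by have := onthTE Q1 k; rewrite Qk => <-.
by rewrite -addnA; apply: loadP; rewrite onth_cat ltnNge leq_addr addKn.
Qed.

Section Execution.
Variables (w : nat) (inp : seq nat) (rk : nat -> nat -> nat).

Lemma run_halted P k l cf :
  let cf' := run w inp rk P k cf in
  k <= l -> halted P cf' -> run w inp rk P l cf = cf'.
Proof.
move=> cf' /subnK <- halt; rewrite /run iterD -/(run w inp rk P k cf) -/cf'.
elim: (l - k) => //= j ->; rewrite /step.
by move: halt; rewrite /halted leqNgt -onthTE; case: onth.
Qed.

Definition reaches P k cf p (B : assertion) : Prop :=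
  exists2 j, j <= k &
    let cf' := run w inp rk P j cf in pc cf' = p /\ holds B cf'.

Lemma reaches_refl P k p r m t (B : assertion) :
  B r m t -> reaches P k (Config p r m t) p B.
Proof. by exists 0. Qed.

Lemma reaches_step P k p r m t q i (B : assertion) : onth P p = Some i ->
  reaches P k (exec w inp rk i (Config p r m t)) q B ->
  reaches P k.+1 (Config p r m t) q B.
Proof.
by move=> Pi [j le_jk reach]; exists j.+1; rewrite // /run iterSr /step Pi.
Qed.

Lemma reaches_trans P k l cf p q (A B : assertion) : reaches P k cf p A ->
  (forall cf', pc cf' = p -> holds A cf' -> reaches P l cf' q B) ->
  reaches P (k + l) cf q B.
Proof.
move=> [j le_jk [pcA holdsA]] /(_ _ pcA holdsA)[j' le_j'l reach].
by exists (j' + j); [rewrite addnC leq_add | rewrite /run iterD].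
Qed.

Definition triple (A : assertion) (c : command) (k : nat) (B : assertion) :
    Prop :=
  forall P cf, loaded P (pc cf) (compile (pc cf) c) -> holds A cf ->
  reaches P k cf (pc cf + size (compile (pc cf) c)) B.

Definition exec_block (code : seq instr) (cf : config) : config :=
  foldl (fun cf i => exec w inp rk i cf) cf code.

Lemma triple_weaken (A A' : assertion) c k k' (B B' : assertion) :
  triple A c k B -> (forall r m t, A' r m t -> A r m t) ->
  (forall r m t, B r m t -> B' r m t) -> k <= k' -> triple A' c k' B'.
Proof.
move=> tripleA A'A BB' le_k P cf loadP /A'A/(tripleA P cf loadP).
move=> [j le_j [pcB postB]].
by exists j; [apply: leq_trans le_k | split=> //; apply: BB'].
Qed.

Lemma triple_leq (A : assertion) c k k' (B : assertion) :
  triple A c k B -> k <= k' -> triple A c k' B.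
Proof. by move=> tripleA; apply: triple_weaken tripleA _ _. Qed.

Lemma triple_fact (fact : Prop) (A : assertion) c k (B : assertion) :
  (forall r m t, A r m t -> fact) -> (fact -> triple A c k B) -> triple A c k B.
Proof.
move=> factA tripleA P cf loadP holdsA.
by apply: tripleA => //; apply: factA holdsA.
Qed.

(* Straight-line instructions ignore the program counter, hence the 0. *)
Lemma triple_block (A : assertion) code (B : assertion) : all straight code ->
  (forall r m t, A r m t -> holds B (exec_block code (Config 0 r m t))) ->
  triple A (Block code) (size code) B.
Proof.
move=> all_code blockB P [p r m t] /= loadP /blockB.
elim: code p 0 r m t all_code loadP {blockB} => [|i code IH] p p' r m t /=.
  by rewrite addn0 => *; apply: reaches_refl.
move=> /andP[i_straight code_straight] /loaded_cons[Pi loadP] postB.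
apply: (reaches_step Pi); rewrite addnS -addSn.
by case: i i_straight {Pi} postB => //= *; apply: IH; eassumption.
Qed.

Lemma triple_then (A : assertion) c1 k1 (B : assertion) c2 k2 (D : assertion) :
  triple A c1 k1 B -> triple B c2 k2 D -> triple A (c1 ;; c2) (k1 + k2) D.
Proof.
move=> triple1 triple2 P cf /= /loaded_cat[load1 load2].
move=> /(triple1 P cf load1) reach1.
apply: (reaches_trans reach1) => cf' pc_cf'; rewrite -pc_cf' size_cat addnA.
by rewrite -pc_cf' in load2 *; apply: triple2.
Qed.

Lemma triple_if (A : assertion) a b c1 c2 k (B : assertion) :
  triple (fun r m t => A r m t /\ r a < r b) c1 k B ->
  triple (fun r m t => A r m t /\ r b <= r a) c2 k B ->
  triple A (IfLt a b c1 c2) k.+2 B.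
Proof.
move=> triple1 triple2 P [p r m t] /= /loaded_cons[Pp /loaded_cat[load2]].
set code2 := compile p.+1 c2 in load2 *; set p1 := p.+2 + size code2.
set code1 := compile p1 c1; rewrite addSn => /loaded_cons[Pjump load1] holdsA.
have -> : p + (size (code2 ++ Jump (p1 + size code1) :: code1)).+1
    = p1 + size code1 by rewrite size_cat /= /p1; lia.
apply: (reaches_step Pp) => /=; case: ltnP => [lt_ab|le_ba].
  have [j le_jk reach] := triple1 P (Config p1 r m t) load1 (conj holdsA lt_ab).
  by exists j => //; apply: ltnW.
rewrite -addn1; apply: reaches_trans.
  exact: (triple2 P (Config p.+1 r m t) load2 (conj holdsA le_ba)).
move=> [_ r' m' t'] /= -> holdsB; apply: (reaches_step Pjump).
exact: reaches_refl.
Qed.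

Lemma triple_while (Inv : nat -> assertion) N a b c k :
  (forall i r m t, i <= N -> Inv i r m t -> (r a < r b) = (i < N)) ->
  (forall i, i < N -> triple (Inv i) c k (Inv i.+1)) ->
  triple (Inv 0) (WhileLt a b c) (N * k.+2 + 2) (Inv N).
Proof.
move=> testE tripleA P [p r m t] /= /loaded_cons[Ptest /loaded_cons[Pexit]].
set code := compile p.+2 c; rewrite -cats1 => /loaded_cat[load_c].
move=> /loaded_cons[Pback _].
have -> : p + (size (code ++ [:: Jump p])).+2 = p.+3 + size code.
  by rewrite size_cat /=; lia.
suff iterate d i r' m' t' : i + d = N -> Inv i r' m' t' ->
    reaches P (d * k.+2 + 2) (Config p r' m' t') (p.+3 + size code) (Inv N).
  exact: iterate.
elim: d i r' m' t' => [|d IH] i {}r {}m {}t.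
  rewrite addn0 => -> inv; apply: (reaches_step Ptest).
  rewrite /= (testE _ _ _ _ (leqnn N) inv) ltnn; apply: (reaches_step Pexit).
  exact: reaches_refl.
move=> NE inv; have lt_iN : i < N by rewrite -NE addnS ltnS leq_addr.
rewrite mulSn -addnA addSn; apply: (reaches_step Ptest).
rewrite /= (testE _ _ _ _ (ltnW lt_iN) inv) lt_iN addSnnS.
apply: reaches_trans (tripleA i lt_iN P (Config p.+2 r m t) load_c inv) _.
move=> [_ r' m' t'] /= -> inv'; apply: (reaches_step Pback).
by apply: (IH i.+1) => //; rewrite addSnnS.
Qed.

Lemma triple_run (A : assertion) c k (B : assertion) K args m t :
  triple A c k B -> k <= K -> A (nth 0 args) m t ->
  let cf := run w inp rk (compile 0 c) K (start args m t) in
  halted (compile 0 c) cf /\ holds B cf.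
Proof.
move=> tripleA le_kK preA cf.
have [j le_jk [halt postB]] :=
  tripleA (compile 0 c) (start args m t) (@loaded0 _) preA.
by rewrite /cf (run_halted (leq_trans le_jk le_kK)) ?/halted ?halt.
Qed.

End Execution.

Arguments compile : simpl never.

(** * Sorted rotations *)

Section InitialSegments.
Variable T : Type.
Implicit Types (P Q : pred T) (s : seq T).

Definition initial_segment P s : bool := pairwise (fun x y => P y ==> P x) s.

Lemma cat_filter_initial_segment P s :
  initial_segment P s -> s = filter P s ++ filter (predC P) s.
Proof.
elim: s => //= x s IH /andP[Px /IH defs].
case: (P x) Px => /= Px; first by rewrite -defs.
suff P0 : filter P s = [::] by rewrite P0 [in LHS]defs P0.
by apply/size0nil/eqP; rewrite size_filter eqn0Ngt -has_count -all_predC.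
Qed.

Lemma count_take_initial_segment P Q s :
  initial_segment P s -> count Q (take (count P s) s) = count (predI Q P) s.
Proof.
move/cat_filter_initial_segment=> defs.
suff -> : take (count P s) s = filter P s by rewrite count_filter.
by rewrite {2}defs -size_filter take_size_cat.
Qed.

Lemma nth_initial_segment x0 P s j :
  initial_segment P s -> j < size s -> P (nth x0 s j) = (j < count P s).
Proof.
move/cat_filter_initial_segment=> defs lt_j.
rewrite {1}defs nth_cat -size_filter; case: ltnP => [lt_jP|le_Pj].
  exact: (all_nthP x0 (filter_all P s)).
apply/negbTE; apply: (all_nthP x0 (filter_all (predC P) s)).
by rewrite ltn_subLR // -size_cat -defs.
Qed.

End InitialSegments.

Lemma sum_count (T : Type) (P : pred T) s : \sum_(x <- s) P x = count P s.
Proof. by rewrite -sumn_count sumnE big_map. Qed.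

Lemma eq_count_add (T : eqType) (P Q1 Q2 : pred T) s :
  {in s, forall x, P x = Q1 x + Q2 x :> nat} ->
  count P s = count Q1 s + count Q2 s.
Proof. by move=> PE; rewrite -!sum_count -big_split; apply: eq_big_seq. Qed.

Lemma perm_map_rot1_rotations (T : eqType) (s : seq T) :
  perm_eq (map (rot 1) (rotations s)) (rotations s).
Proof.
rewrite /rotations -map_comp.
have -> : map (rot 1 \o rot^~ s) (iota 0 (size s)) =
    map (rot^~ s) (iota 1 (size s)).
  rewrite (iotaDl 1 0) -map_comp; apply/eq_in_map => i.
  by rewrite mem_iota /= add0n add1n => /rotS->.
case: (size s) (rot_size s) => // n rot_n.
have := iotaD 1 n 1; rewrite addn1 add1n => ->.
by rewrite map_cat /= rot0 rot_n cats1 perm_rcons.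
Qed.

Lemma nth_flatten_uniform (T : Type) (x0 : T) m rows i j :
  all (fun row => size row == m) rows -> i < size rows -> j < m ->
  nth x0 (flatten rows) (m * i + j) = nth x0 (nth [::] rows i) j.
Proof.
elim: rows i => //= row rows IH i /andP[/eqP size_row size_rows] lt_i lt_j.
rewrite nth_cat size_row; case: i lt_i => [|i] lt_i.
  by rewrite muln0 lt_j.
by rewrite ltnNge mulnS -addnA leq_addr addKn IH.
Qed.

Lemma prefix_cat_short (T : eqType) (x u v : seq T) :
  size x <= size u -> prefix x (u ++ v) = prefix x u.
Proof. by move=> le_xu; rewrite !prefixE takel_cat. Qed.

Section Comparison.
Variables (T : eqType) (pi : seq T -> rel T).
Implicit Types (a b c d : T) (u v x y z il : seq T).

(* [prec y u v] compares the words [y ++ u] and [y ++ v]. *)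
Fixpoint prec y u v : bool :=
  match u, v with
  | a :: u', b :: v' => if a == b then prec (rcons y a) u' v' else pi y a b
  | _, _ => false
  end.

Lemma precedesE u v : precedes pi u v = prec [::] u v.
Proof.
suff in_context f y :
    (forall z, f z =2 pi (y ++ z)) -> precedes f u v = prec y u v.
  exact: in_context.
elim: u v f y => [|a u IH] [|b v] f y fE; rewrite /precedes //=.
case: eqVneq => [<-|neq_ab] /=; last by rewrite neq_ab fE cats0.
by apply: (IH v (fun z => f (a :: z))) => z c d; rewrite fE cat_rcons.
Qed.

Lemma prec0 y u : prec y u [::] = false.
Proof. by case: u. Qed.

Lemma prefix_precF y x u : prefix x u -> prec y u x = false.
Proof.
by elim: x u y => [|a x IH] [|b u] y //=; rewrite eq_sym; case: eqP => // _ /IH.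
Qed.

Lemma prec_catl y u v x : size x <= size u -> prec y (u ++ v) x = prec y u x.
Proof.
elim: x u y => [|a x IH] [|b u] y //= le_xu; first by rewrite prec0.
by rewrite IH.
Qed.

Lemma prec_catr y u z x :
  prec y u (z ++ x) =
    prec y u z + (prefix z u && prec (y ++ z) (drop (size z) u) x) :> nat.
Proof.
elim: z u y => [|a z IH] u y; first by rewrite prec0 prefix0s drop0 cats0.
case: u => //= b u; rewrite eq_sym.
case: eqP => [->|_] /=; last by rewrite addn0.
by rewrite IH cat_rcons.
Qed.

Lemma prec_or_prefix y u v x : size x <= size u ->
  prec y u v -> prefix x v -> prec y u x || prefix x u.
Proof.
elim: u v x y => [|a u IH] [|b v] [|c x] y //= le_xu.
rewrite eq_sym [b == a]eq_sym; case: eqVneq => [<-|neq_ab].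
  by case: eqVneq => [<-|_] //= uv /(IH _ _ _ le_xu uv).
by move=> pi_ab /andP[/eqP-> _]; rewrite (negbTE neq_ab) pi_ab.
Qed.

Lemma prec_symbol y il d v k : total_order (pi y) -> sorted (pi y) il ->
  uniq il -> d \in il -> k < size il ->
  prec y (d :: v) [:: nth d il k] = (d \in take k il).
Proof.
move=> [_ asym tr _] il_sorted il_uniq d_il lt_k /=; rewrite in_take //.
have nth_il : nth d il k \in il by exact: mem_nth.
case: eqVneq => [{2}->|neq]; first by rewrite index_uniq // ltnn prec0.
rewrite -[k in RHS](index_uniq d lt_k il_uniq); case: ltngtP => [lt|lt|eq].
- exact: (sorted_ltn_index tr il_sorted).
- apply/negP => le; case/eqP: neq; apply: asym; rewrite le.
  exact: (sorted_ltn_index tr il_sorted).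
- by case/eqP: neq; rewrite -{1}(nth_index d d_il) eq nth_index.
Qed.

Lemma prec_local (pi_eps : rel T) (pi_sym : T -> rel T) y z u v :
  local_ordering pi pi_eps pi_sym -> z != [::] ->
  prec (y ++ z) u v = prec z u v.
Proof.
move=> [_ localE]; elim: u v z => [|a u IH] [|b v] z //= z_neq0.
case: eqP => _; first by rewrite rcons_cat IH // -size_eq0 size_rcons.
by case/lastP: z z_neq0 => // z c _; rewrite -rcons_cat !localE.
Qed.

Hypothesis pi_total : forall y, total_order (pi y).

Lemma prec_trans y v u x : prec y u v -> prec y v x -> prec y u x.
Proof.
elim: u v x y => [|a u IH] [|b v] [|c x] y //=.
have [_ asym tr _] := pi_total y.
case: (eqVneq a b) => [<-|neq_ab]; first by case: eqVneq => // _; apply: IH.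
case: (eqVneq b c) => [<-|neq_bc] ab bc; first by rewrite (negbTE neq_ab).
case: (eqVneq a c) => [eq_ac|_]; last exact: tr bc.
by case/eqP: neq_ab; apply: asym; rewrite ab eq_ac.
Qed.

Lemma prec_total y u v :
  size u = size v -> [|| u == v, prec y u v | prec y v u].
Proof.
elim: u v y => [|a u IH] [|b v] y //= [size_uv]; rewrite eqseq_cons.
rewrite [b == a]eq_sym; case: eqVneq => [<-|_] /=; first exact: IH.
by have [_ _ _ tot] := pi_total y; apply: tot.
Qed.

End Comparison.

Section Matrix.
Variables (T : eqType) (pi : seq T -> rel T) (s : seq T).
Hypothesis pi_total : forall y, total_order (pi y).
Local Notation M := (Mstar pi s).
Local Notation L := (BWTstar pi s).
Local Notation n := (size s).
Implicit Types (Q : pred (seq T)) (u v x y z il : seq T) (a b c d : T).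

Definition before x : pred (seq T) := fun u => prec pi [::] u x.
Definition before_or_in x : pred (seq T) := fun u => before x u || prefix x u.
Definition ends_in c : pred (seq T) := fun u => ohead (rev u) == Some c.

Definition first_row x : nat := count (before x) M.
Definition num_rows x : nat := count (prefix x) M.
Definition range_start x : nat :=
  if num_rows x == 0 then 0 else (first_row x).+1.
Definition symbol_rank c j : nat := count_mem c (take j L).

Lemma perm_Mstar : perm_eq M (rotations s).
Proof. by rewrite /Mstar perm_sort. Qed.

Lemma size_Mstar : size M = n.
Proof. by rewrite (perm_size perm_Mstar) size_map size_iota. Qed.

Lemma size_row u : u \in M -> size u = n.
Proof. by rewrite (perm_mem perm_Mstar) => /mapP[i _ ->]; rewrite size_rot. Qed.

Lemma size_row_gt0 u : u \in M -> 0 < size u.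
Proof. by move=> uM; rewrite (size_row uM) -size_Mstar; case: M uM. Qed.

Lemma Mstar_pairwise : pairwise (fun u v => (u == v) || prec pi [::] u v) M.
Proof.
rewrite /Mstar; set le := fun u v => (u == v) || precedes pi u v.
suff : pairwise le (sort le (rotations s)).
  by apply: sub_pairwise => u v; rewrite /le precedesE.
pose P := [pred u : seq T | size u == n].
have allP : all P (rotations s).
  by apply/allP=> _ /mapP[i _ ->]; rewrite inE size_rot.
rewrite -(@sorted_pairwise_in _ P); last by rewrite all_sort.
  apply: (sort_sorted_in _ allP) => u v /eqP size_u /eqP size_v.
  have := prec_total pi_total [::] (etrans size_u (esym size_v)).
  by rewrite /le !precedesE [v == u]eq_sym; case: eqP.
move=> v u x _ _ _; rewrite /le !precedesE.
case/orP=> [/eqP-> //|uv] /orP[/eqP<-|vx]; rewrite ?uv ?orbT //.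
by rewrite (prec_trans pi_total uv vx) orbT.
Qed.

Lemma before_initial x : initial_segment (before x) M.
Proof.
apply: sub_pairwise Mstar_pairwise => u v /orP[/eqP->|uv]; first exact: implybb.
by apply/implyP; apply: prec_trans.
Qed.

Lemma before_or_in_initial x :
  size x <= n -> initial_segment (before_or_in x) M.
Proof.
move=> le_xn.
apply: (sub_in_pairwise (P := mem M)) Mstar_pairwise; last exact/allP.
move=> u v uM _ /orP[/eqP->|uv]; first exact: implybb.
apply/implyP=> /orP[vx|xv].
  by rewrite /before_or_in /before (prec_trans pi_total uv vx).
by apply: (prec_or_prefix _ uv xv); rewrite (size_row uM).
Qed.

Lemma count_before_or_in Q x :
  count (predI Q (before_or_in x)) M =
  count (predI Q (before x)) M + count (predI Q (prefix x)) M.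
Proof.
apply: eq_count_add => u _; rewrite /= /before_or_in /before.
case: (boolP (prefix x u)) => [xu|_]; last by rewrite orbF andbF addn0.
by rewrite (prefix_precF _ _ xu) andbF.
Qed.

Lemma first_row_num_rows x :
  first_row x + num_rows x = count (before_or_in x) M.
Proof. by have := count_before_or_in predT x. Qed.

Lemma first_row_num_rows_le x : first_row x + num_rows x <= n.
Proof. by rewrite first_row_num_rows -size_Mstar count_size. Qed.

Lemma size_num_rows_neq0 x : num_rows x != 0 -> size x <= n.
Proof.
by rewrite -lt0n -has_count => /hasP[u uM /size_prefix]; rewrite (size_row uM).
Qed.

Lemma first_row_nil : first_row [::] = 0.
Proof.
by rewrite -(count_pred0 M); apply: eq_count => u; rewrite /before prec0.
Qed.

Lemma num_rows_nil : num_rows [::] = n.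
Proof.
by rewrite -size_Mstar -(count_predT M); apply: eq_count => u; apply: prefix0s.
Qed.

Lemma is_range_num_rows x : is_range M x (range_start x) (num_rows x).
Proof.
rewrite /is_range /range_start has_count -/(num_rows x) lt0n.
case: eqVneq => [-> //|/size_num_rows_neq0 le_xn [|j] //=].
rewrite ltnS addSn ltnS first_row_num_rows.
case: (ltnP j (size M)) => /= lt_j; last first.
  by have := count_size (before_or_in x) M; lia.
rewrite -(nth_initial_segment [::] (before_or_in_initial le_xn)) //.
rewrite leqNgt -(nth_initial_segment [::] (before_initial x)) //.
rewrite /before_or_in /before; case: (boolP (prefix x _)) => [xu|_].
  by rewrite (prefix_precF _ _ xu) orbT.
by rewrite orbF andNb.
Qed.

Lemma symbol_rankE c j : symbol_rank c j = count (ends_in c) (take j M).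
Proof.
rewrite /symbol_rank /BWTstar.
have : all (fun u => 0 < size u) M by apply/allP => u /size_row_gt0.
elim: M j => [|u M' IH] [|j] //= /andP[u_gt0 M'_gt0]; first by rewrite !take0.
by case: (lastP u) u_gt0 => // v b _; rewrite /ends_in rev_rcons /= IH.
Qed.

Lemma symbol_rank_le c j : symbol_rank c j <= n.
Proof.
rewrite symbol_rankE -size_Mstar (leq_trans (count_size _ _)) //.
by rewrite size_take_min geq_minr.
Qed.

Lemma symbol_rank_first c x :
  symbol_rank c (first_row x) = count (predI (ends_in c) (before x)) M.
Proof.
by rewrite symbol_rankE count_take_initial_segment //; apply: before_initial.
Qed.

(* Rotating a row by one position brings its last symbol to the front. *)
Lemma count_ends_in c Q :
  count (predI (ends_in c) Q) M =
  count (fun u => if u is b :: v then (b == c) && Q (rcons v b) else false) M.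
Proof.
rewrite !(permP perm_Mstar) -(permP (perm_map_rot1_rotations s)) count_map.
apply: eq_in_count => u; rewrite -(perm_mem perm_Mstar) => /size_row_gt0.
by case: u => // b v _; rewrite /= rot1_cons /ends_in rev_rcons.
Qed.

Lemma symbol_rank_range c x : size x < n ->
  symbol_rank c (first_row x + num_rows x) =
  symbol_rank c (first_row x) + num_rows (c :: x).
Proof.
move=> lt_xn; rewrite first_row_num_rows symbol_rankE.
rewrite count_take_initial_segment; last exact/before_or_in_initial/ltnW.
rewrite count_before_or_in -symbol_rank_first count_ends_in; congr (_ + _).
apply: eq_in_count => -[|b v] /size_row //= size_v.
by rewrite eq_sym -cats1 prefix_cat_short //; lia.
Qed.

Lemma num_rows_symbol c : 0 < n -> num_rows [:: c] = symbol_rank c n.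
Proof.
move=> n_gt0.
rewrite -[in RHS]num_rows_nil -[num_rows [::]]add0n -first_row_nil.
by rewrite symbol_rank_range // first_row_nil /symbol_rank take0.
Qed.

Definition between z x : pred (seq T) :=
  fun u => prefix z u && prec pi z (drop (size z) u) x.

Lemma count_before_cat Q z x :
  count (predI Q (before (z ++ x))) M =
  count (predI Q (before z)) M + count (predI Q (between z x)) M.
Proof.
apply: eq_count_add => u _; rewrite /= /before /between.
by case: (Q u); rewrite //= prec_catr.
Qed.

Lemma first_row_cat z x :
  first_row (z ++ x) = first_row z + count (between z x) M.
Proof. exact: (count_before_cat predT). Qed.

(* Since [z] is nonempty, the order of two rows prefixed by [z] is still that *)
(* of their continuations once a last symbol [c] is moved to the front.       *)
Lemma first_row_cons pi_eps pi_sym c z x :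
  local_ordering pi pi_eps pi_sym -> z != [::] -> size (z ++ x) < n ->
  first_row (c :: z ++ x) + symbol_rank c (first_row z) =
  first_row (c :: z) + symbol_rank c (first_row (z ++ x)).
Proof.
move=> pi_local z_neq0; rewrite size_cat => lt_zxn.
rewrite -cat_cons first_row_cat !symbol_rank_first count_before_cat.
rewrite addnAC addnA; congr (_ + _); rewrite count_ends_in.
apply: eq_in_count => -[|b v] /size_row //= size_v.
rewrite /between /= [c == b]eq_sym -andbA; congr (_ && _).
rewrite -cats1 prefix_cat_short; last lia.
case: (boolP (prefix z v)) => //= /prefixP[v' defv].
move: size_v; rewrite defv size_cat -catA !drop_size_cat // => size_v.
by rewrite prec_catl; [rewrite -cat1s (prec_local [:: c] _ _ pi_local) | lia].
Qed.

Lemma first_row_rcons il d y k : sorted (pi y) il -> uniq il ->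
  (forall a, a \in il) -> k < size il ->
  first_row (rcons y (nth d il k)) =
  first_row y + \sum_(a <- take k il) num_rows (rcons y a).
Proof.
move=> il_sorted il_uniq il_full lt_k.
rewrite -cats1 first_row_cat; congr (_ + _).
rewrite -sum_count; under [RHS]eq_bigr do rewrite /num_rows -sum_count.
rewrite exchange_big; apply: eq_big_seq => u _.
under eq_bigr => a _ do rewrite -cats1.
rewrite /between.
case: (boolP (prefix y u)) => [/prefixP[v ->]|not_yu] /=; last first.
  rewrite big1 // => a _; apply/eqP; rewrite eqb0.
  by apply: contra not_yu; apply: catl_prefix.
rewrite drop_size_cat //.
under eq_bigr => a _ do rewrite prefix_catr // eqxx /=.
case: v => [|b v] /=; first by rewrite big1 // => a _; case: eqP.
under eq_bigr => a _ do rewrite prefix0s andbT.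
rewrite sum_count count_uniq_mem ?take_uniq //.
by rewrite (set_nth_default b) // -(prec_symbol v (pi_total y) il_sorted).
Qed.

Lemma first_row_sum_le il y k : sorted (pi y) il -> uniq il ->
  (forall a, a \in il) -> k <= size il ->
  first_row y + \sum_(a <- take k il) num_rows (rcons y a) <= n.
Proof.
move=> il_sorted il_uniq il_full; case: k => [|k] lt_k.
  rewrite take0 big_nil addn0.
  exact: leq_trans (leq_addr _ _) (first_row_num_rows_le y).
have d : T by case: il lt_k {il_sorted il_uniq il_full}.
rewrite (take_nth d lt_k) big_rcons /= addnA -(first_row_rcons d) //.
exact: first_row_num_rows_le.
Qed.

End Matrix.

(** * The index *)

Section IncreasingList.
Variables (sigma : nat) (r : rel 'I_sigma).

Lemma size_increasing_list : size (increasing_list r) = sigma.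
Proof. by rewrite size_sort size_enum_ord. Qed.

Lemma increasing_list_uniq : uniq (increasing_list r).
Proof. by rewrite sort_uniq enum_uniq. Qed.

Lemma mem_increasing_list a : a \in increasing_list r.
Proof. by rewrite mem_sort mem_enum. Qed.

Lemma increasing_list_sorted r' :
  total_order r' -> r' =2 r -> sorted r' (increasing_list r).
Proof.
move=> [_ _ _ tot] rr'; rewrite (eq_sorted rr').
by apply: sort_sorted => a b; rewrite -!rr'; apply: tot.
Qed.

End IncreasingList.

Section OrderTable.
Variables (sigma : nat).
Variables (pi_eps : rel 'I_sigma) (pi_sym : 'I_sigma -> rel 'I_sigma).
Local Notation tab := (order_table pi_eps pi_sym).

Lemma nth_order_table_eps d k : k < sigma ->
  nth 0 tab k = nth d (increasing_list pi_eps) k.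
Proof.
move=> lt_k; rewrite /order_table /code map_cat nth_cat size_map.
by rewrite size_increasing_list lt_k (nth_map d) ?size_increasing_list.
Qed.

Lemma nth_order_table_sym d (c : 'I_sigma) k : k < sigma ->
  nth 0 tab (sigma * c.+1 + k) = nth d (increasing_list (pi_sym c)) k.
Proof.
move=> lt_k; rewrite mulnS -addnA /order_table /code map_cat nth_cat size_map.
rewrite size_increasing_list ltnNge leq_addr addKn map_flatten -map_comp /=.
set rows := map _ _.
have size_rows : all (fun row => size row == sigma) rows.
  by apply/allP => _ /mapP[a _ ->]; rewrite size_map size_increasing_list.
have nrows : size rows = sigma by rewrite size_map size_enum_ord.
rewrite (nth_flatten_uniform 0 size_rows) ?nrows //.
rewrite (nth_map c) ?size_enum_ord //.
by rewrite nth_ord_enum (nth_map d) ?size_increasing_list.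
Qed.

End OrderTable.

Lemma address_inj sigma i a j b : a < sigma -> b < sigma ->
  sigma * i + a = sigma * j + b -> i = j /\ a = b.
Proof.
move=> lt_a lt_b eq_addr; have sigma_gt0 := leq_ltn_trans (leq0n a) lt_a.
move/(congr1 (divn^~ sigma)): (eq_addr).
rewrite ![sigma * _]mulnC !divnMDl // !divn_small // !addn0 => eq_ij.
by split=> //; move: eq_addr; rewrite eq_ij => /addnI.
Qed.

Section Correctness.
Variables (w sigma : nat) (s : seq 'I_sigma).
Variable pi : seq 'I_sigma -> rel 'I_sigma.
Variables (pi_eps : rel 'I_sigma) (pi_sym : 'I_sigma -> rel 'I_sigma).
Variable d : 'I_sigma.
Hypothesis pi_total : forall y, total_order (pi y).
Hypothesis pi_local : local_ordering pi pi_eps pi_sym.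
Hypothesis s_gt0 : 0 < size s.
Hypothesis s_word : size s < 2 ^ w.
Hypothesis sigma_word : sigma ^ 2 + sigma < 2 ^ w.
Local Notation n := (size s).
Local Notation L := (BWTstar pi s).
Local Notation tab := (order_table pi_eps pi_sym).
Local Notation first_row := (first_row pi s).
Local Notation num_rows := (num_rows pi s).
Local Notation table_size := (sigma ^ 2 + sigma).
Local Notation add := (eval_op w Add).
Local Notation sub := (eval_op w Defs.Sub).
Implicit Types (a b c : 'I_sigma) (x y l : seq 'I_sigma) (m : nat -> nat).

Lemma rankE c j : rank L c j = symbol_rank pi s c j.
Proof. by rewrite /rank /code -map_take count_map. Qed.

Lemma sigma_gt0 : 0 < sigma.
Proof. exact: leq_ltn_trans (ltn_ord d). Qed.

Lemma pi_epsE : pi [::] =2 pi_eps.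
Proof. by case: pi_local. Qed.

Lemma pi_symE c : pi [:: c] =2 pi_sym c.
Proof. by case: pi_local => _ localE; apply: (localE [::]). Qed.

Lemma address_word j : j <= table_size -> j < 2 ^ w.
Proof. by move/leq_ltn_trans; apply. Qed.

Lemma one_word : 1 < 2 ^ w.
Proof. by apply: address_word; have := sigma_gt0; nia. Qed.

Lemma range_word x : first_row x + num_rows x < 2 ^ w.
Proof. exact: leq_ltn_trans (first_row_num_rows_le _ _ _) s_word. Qed.

Lemma rank_word c j : rank L c j < 2 ^ w.
Proof. by rewrite rankE (leq_ltn_trans _ s_word) ?symbol_rank_le. Qed.

Definition first_row_sum y (r : rel 'I_sigma) k : nat :=
  first_row y + \sum_(a <- take k (increasing_list r)) num_rows (rcons y a).

Local Notation symbol r k := (nth d (increasing_list r) k).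

Lemma first_row_sum0 y r : first_row_sum y r 0 = first_row y.
Proof. by rewrite /first_row_sum take0 big_nil addn0. Qed.

Lemma first_row_sumS y r k : k < sigma ->
  first_row_sum y r k.+1 =
  first_row_sum y r k + num_rows (rcons y (symbol r k)).
Proof.
move=> lt_k; rewrite /first_row_sum (take_nth d) ?size_increasing_list //.
by rewrite big_rcons addnA.
Qed.

Lemma first_row_sumE y r k : pi y =2 r -> k < sigma ->
  first_row_sum y r k = first_row (rcons y (symbol r k)).
Proof.
move=> pi_y lt_k; rewrite first_row_rcons ?increasing_list_uniq //.
- exact: increasing_list_sorted.
- exact: mem_increasing_list.
- by rewrite size_increasing_list.
Qed.

Lemma first_row_sum_word y r k : pi y =2 r -> k <= sigma ->
  first_row_sum y r k < 2 ^ w.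
Proof.
move=> pi_y lt_k; apply: leq_ltn_trans s_word.
apply: first_row_sum_le; rewrite ?increasing_list_uniq ?size_increasing_list //.
- exact: increasing_list_sorted.
- exact: mem_increasing_list.
Qed.

Lemma rank_range c x : size x < n ->
  rank L c (add (first_row x) (num_rows x)) =
  rank L c (first_row x) + num_rows (c :: x).
Proof.
by move=> lt_xn; rewrite add_small ?range_word // !rankE symbol_rank_range.
Qed.

Lemma add1_address j : j < table_size -> add j 1 = j.+1.
Proof. by move=> lt_j; rewrite add_small addn1 // address_word. Qed.

Lemma symbol_address_lt a : a < table_size.
Proof. exact: leq_trans (ltn_ord a) (leq_addl _ _). Qed.

Lemma sub_rank_range c x : size x < n ->
  sub (rank L c (add (first_row x) (num_rows x))) (rank L c (first_row x)) =
  num_rows (c :: x).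
Proof.
move=> lt_xn; rewrite sub_small rank_range ?addKn // leq_addr -rank_range //.
exact: rank_word.
Qed.

Definition pair_address c a : nat := sigma * c.+1 + a.

Lemma pair_address_lt c a : pair_address c a < table_size.
Proof. by have := ltn_ord c; have := ltn_ord a; rewrite /pair_address; nia. Qed.

Lemma pair_address_inj c a c' a' :
  pair_address c a = pair_address c' a' -> c = c' /\ a = a'.
Proof. by case/address_inj=> // -[/ord_inj->] /ord_inj->. Qed.

(* Taken modulo 2 ^ w, since it may be negative. *)
Definition offset c a : nat :=
  sub (first_row [:: c; a]) (rank L c (first_row [:: a])).

Lemma add_offset c a x : (size x).+1 < n ->
  add (offset c a) (rank L c (first_row (a :: x))) = first_row [:: c, a & x].
Proof.
move=> lt_xn; apply: add_sub_wrap.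
- rewrite !rankE [RHS]addnC.
  by rewrite -(first_row_cons (z := [:: a]) pi_total _ pi_local).
- exact/ltnW/rank_word.
- exact: leq_ltn_trans (leq_addr _ _) (range_word _).
Qed.

Definition singles_stored l m : Prop :=
  forall a, a \in l -> m a = first_row [:: a].

(* If n = 1, then a row has no second symbol and the recurrence for B (c a)   *)
(* fails.                                                                     *)
Definition pairs_stored (c : nat) l m : Prop :=
  1 < n -> forall c' a, (c' < c) || (c' == c :> nat) && (a \in l) ->
  m (pair_address c' a) = offset c' a.

Definition tables_stored m : Prop :=
  singles_stored (enum 'I_sigma) m /\ pairs_stored sigma [::] m.

Lemma singles_stored_rcons l a m v : v = first_row [:: a] ->
  singles_stored l m -> singles_stored (rcons l a) (upd m a v).
Proof.
move=> -> stored b; rewrite mem_rcons inE -val_eqE /=.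
by case: eqP => [/val_inj->|_ /stored].
Qed.

Lemma singles_stored_pair l c a m v :
  singles_stored l m -> singles_stored l (upd m (pair_address c a) v).
Proof.
move=> stored b /stored /=; case: eqP => // b_addr.
by have := ltn_ord b; rewrite b_addr /pair_address mulnS; lia.
Qed.

Lemma pairs_stored_rcons c l a m v : (1 < n -> v = offset c a) ->
  pairs_stored c l m -> pairs_stored c (rcons l a) (upd m (pair_address c a) v).
Proof.
move=> vE stored n_gt1 c' b; rewrite mem_rcons inE /=.
case: (pair_address c' b =P _) => [/pair_address_inj[-> ->]|neq].
  by rewrite vE.
case/orP=> [lt_c|/andP[/eqP/val_inj eq_c /predU1P[eq_b|b_l]]].
- by apply: stored; rewrite // lt_c.
- by case: neq; rewrite eq_b eq_c.
- by apply: stored; rewrite // eq_c eqxx b_l orbT.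
Qed.

Lemma pairs_stored_row c l m : (forall a, a \in l) ->
  pairs_stored c l m -> pairs_stored c.+1 [::] m.
Proof.
move=> l_full stored n_gt1 c' a; rewrite in_nil andbF orbF ltnS => le_c.
by apply: stored; rewrite // l_full andbT orbC -leq_eqVlt.
Qed.

Section Preprocess.
Local Notation reg_n := 0 (only parsing).
Local Notation reg_sigma := 1 (only parsing).
Local Notation reg_sum := 2 (only parsing).
Local Notation reg_pos := 3 (only parsing).
Local Notation reg_c := 4 (only parsing).
Local Notation reg_a := 5 (only parsing).
Local Notation reg_one := 6 (only parsing).
Local Notation reg_row := 7 (only parsing).
Local Notation reg_stop := 8 (only parsing).
Local Notation reg_first := 9 (only parsing).
Local Notation reg_last := 10 (only parsing).
Local Notation reg_lo := 11 (only parsing).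
Local Notation reg_hi := 12 (only parsing).
Local Notation reg_addr := 13 (only parsing).

Definition store_single : command := Block [::
  ReadInput reg_a reg_pos;
  WriteMem reg_a reg_sum;
  Rank reg_hi reg_a reg_n;
  Op Add reg_sum reg_sum reg_hi;
  Op Add reg_pos reg_pos reg_one].

(* [reg_sum] goes from B (c a) to the offset B (c a) - rank_c (B a), and then *)
(* to B (c a) + l (c a).                                                      *)
Definition store_pair : command := Block [::
  ReadInput reg_a reg_pos;
  ReadMem reg_first reg_a;
  Rank reg_last reg_a reg_n;
  Op Add reg_last reg_first reg_last;
  Rank reg_lo reg_c reg_first;
  Rank reg_hi reg_c reg_last;
  Op Defs.Sub reg_sum reg_sum reg_lo;
  Op Add reg_addr reg_row reg_a;
  WriteMem reg_addr reg_sum;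
  Op Add reg_sum reg_sum reg_hi;
  Op Add reg_pos reg_pos reg_one].

Definition store_row : command := (
  Block [:: ReadMem reg_sum reg_c; Op Add reg_stop reg_row reg_sigma];;
  WhileLt reg_pos reg_stop store_pair;;
  Block [:: Move reg_row reg_stop; Op Add reg_c reg_c reg_one])%C.

Definition preprocess_command : command := (
  Block [:: Const reg_one 1];;
  WhileLt reg_pos reg_sigma store_single;;
  Block [:: Move reg_row reg_sigma; Const reg_c 0];;
  WhileLt reg_c reg_sigma store_row)%C.

Local Notation triple := (triple w tab (rank L)).

Definition constants_set (r : nat -> nat) (t : nat) : Prop :=
  [/\ r reg_n = n, r reg_sigma = sigma, r reg_one = 1 & t <= table_size].

Definition singles_inv k : assertion := fun r m t =>
  [/\ constants_set r t, r reg_pos = k, r reg_sum = first_row_sum [::] pi_eps k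
    & singles_stored (take k (increasing_list pi_eps)) m].

Definition rows_inv (c : nat) : assertion := fun r m t =>
  [/\ constants_set r t,
      [/\ r reg_pos = sigma * c.+1, r reg_row = sigma * c.+1 & r reg_c = c],
      singles_stored (enum 'I_sigma) m & pairs_stored c [::] m].

Definition row_inv c k : assertion := fun r m t =>
  [/\ constants_set r t,
      [/\ r reg_pos = sigma * c.+1 + k, r reg_row = sigma * c.+1,
          r reg_stop = sigma * c.+1 + sigma, r reg_c = c
        & 1 < n -> r reg_sum = first_row_sum [:: c] (pi_sym c) k],
      singles_stored (enum 'I_sigma) m
    & pairs_stored c (take k (increasing_list (pi_sym c))) m].

Lemma store_single_correct k : k < sigma ->
  triple (singles_inv k) store_single 5 (singles_inv k.+1).
Proof.
move=> lt_k; apply: triple_block => // r m t.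
move=> [[rn rsigma rone le_t] rpos rsum stored].
have pi_eps' := pi_epsE; have /= sumS := first_row_sumS [::] pi_eps lt_k.
rewrite /holds /singles_inv /constants_set /= rn rone rpos rsum.
rewrite (nth_order_table_eps _ _ d) // rankE -(num_rows_symbol pi_total) //.
rewrite add1_address; last by nia.
rewrite add_small -?sumS ?first_row_sum_word //.
split=> //; first by split; rewrite // geq_max le_t symbol_address_lt.
rewrite (take_nth d) ?size_increasing_list //.
by apply: singles_stored_rcons; rewrite // first_row_sumE.
Qed.

Lemma store_pair_correct (c : 'I_sigma) k : k < sigma ->
  triple (row_inv c k) store_pair 11 (row_inv c k.+1).
Proof.
move=> lt_k; apply: triple_block => // r m t.
move=> [[rn rsigma rone le_t] [rpos rrow rstop rc rsum] singles pairs].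
rewrite /holds /row_inv /constants_set /= rn rsigma rone rpos rrow rc.
have pi_c := pi_symE c.
rewrite (nth_order_table_sym _ _ d) //; set a := symbol (pi_sym c) k.
rewrite singles ?mem_enum // [rank L a n]rankE -(num_rows_symbol pi_total) //.
have -> : add (sigma * c.+1) a = pair_address c a.
  by apply/add_small/address_word/ltnW/pair_address_lt.
rewrite add1_address; last by have := ltn_ord c; nia.
have sumE : 1 < n -> r reg_sum = first_row [:: c; a].
  by move=> n_gt1; rewrite rsum // first_row_sumE.
split.
- by split=> //; rewrite !geq_max le_t symbol_address_lt pair_address_lt.
- split=> //; first by rewrite addnS.
  move=> n_gt1; rewrite rank_range // rsum // first_row_sumS //.
  apply: add_sub_wrap; first by rewrite addnCA.
    exact/ltnW/rank_word.
  by rewrite -first_row_sumS ?first_row_sum_word.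
- exact: singles_stored_pair.
rewrite (take_nth d) ?size_increasing_list //.
by apply: pairs_stored_rcons => // /sumE->.
Qed.

Lemma store_row_correct (c : nat) : c < sigma ->
  triple (rows_inv c) store_row (sigma * 13 + 6) (rows_inv c.+1).
Proof.
move=> lt_c; pose c' := Ordinal lt_c.
have -> : sigma * 13 + 6 = 2 + (sigma * 13 + 2 + 2) by lia.
apply: (triple_then (B := row_inv c' 0)).
  apply: triple_block => // r m t.
  move=> [[rn rsigma rone le_t] [rpos rrow rc] singles pairs].
  rewrite /holds /row_inv /constants_set /= rn rsigma rone rpos rrow rc.
  rewrite addn0 take0 add_small; last by apply: address_word; nia.
  split=> //; first by split; rewrite // geq_max le_t /=; nia.
  by split=> // _; rewrite first_row_sum0 -[c]/(val c') singles ?mem_enum.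
apply: (triple_then (B := row_inv c' sigma)).
  apply: triple_while => [k r m t _ [_ [-> _ -> _ _] _ _]|k lt_k].
    by rewrite ltn_add2l.
  exact: store_pair_correct.
apply: triple_block => // r m t.
move=> [[rn rsigma rone le_t] [rpos rrow rstop rc _] singles pairs].
rewrite /holds /rows_inv /constants_set /= rn rsigma rone rpos rstop rc.
rewrite (add1_address (symbol_address_lt c')).
rewrite -mulnSr; split=> //; apply: pairs_stored_row pairs => a.
by rewrite take_oversize ?size_increasing_list // mem_increasing_list.
Qed.

Lemma preprocess_correct :
  triple (fun r m t => r = nth 0 [:: n; sigma] /\ t = 0)
    preprocess_command (35 * sigma ^ 2)
    (fun r m t => tables_stored m /\ t <= table_size).
Proof.
pose cost := 1 + (sigma * 7 + 2 + (2 + (sigma * (sigma * 13 + 6).+2 + 2))).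
apply: (triple_weaken (A := fun r m t => r = nth 0 [:: n; sigma] /\ t = 0)
    (B := rows_inv sigma) (k := cost)) => //; first last.
- by rewrite /cost; have := sigma_gt0; nia.
- by move=> r m t [[_ _ _ le_t] _ singles pairs].
apply: (triple_then (B := singles_inv 0)).
  apply: triple_block => // r m t [-> ->].
  rewrite /holds /singles_inv /constants_set /= wrap_small ?one_word //.
  by rewrite take0 first_row_sum0 first_row_nil.
apply: (triple_then (B := singles_inv sigma)).
  apply: triple_while => [k r m t _ [[_ -> _ _] -> _ _] //|k lt_k].
  exact: store_single_correct.
apply: (triple_then (B := rows_inv 0)).
  apply: triple_block => // r m t [[rn rsigma rone le_t] rpos rsum].
  rewrite take_oversize ?size_increasing_list // => singles.
  rewrite /holds /rows_inv /constants_set /= rn rsigma rone rpos muln1.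
  rewrite wrap_small ?expn_gt0 //.
  split=> // [a _|_ c a]; last by rewrite in_nil andbF.
  exact/singles/mem_increasing_list.
apply: triple_while => [c r m t _ [[_ -> _ _] [_ _ ->] _ _] //|c lt_c].
exact: store_row_correct.
Qed.

End Preprocess.

Section Query.
Variable x : seq 'I_sigma.
Hypothesis x_word : size x < 2 ^ w.

Local Notation reg_n := 0 (only parsing).
Local Notation reg_sigma := 1 (only parsing).
Local Notation reg_size := 2 (only parsing).
Local Notation reg_pos := 3 (only parsing).
Local Notation reg_c := 4 (only parsing).
Local Notation reg_a := 5 (only parsing).
Local Notation reg_one := 6 (only parsing).
Local Notation reg_first := 7 (only parsing).
Local Notation reg_num := 8 (only parsing).
Local Notation reg_last := 9 (only parsing).
Local Notation reg_lo := 10 (only parsing).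
Local Notation reg_hi := 11 (only parsing).
Local Notation reg_addr := 12 (only parsing).
Local Notation reg_zero := 13 (only parsing).
Local Notation out_start := 0 (only parsing).
Local Notation out_num := 1 (only parsing).

Definition load_last_symbol : command := Block [::
  Const reg_one 1;
  Op Defs.Sub reg_pos reg_size reg_one;
  ReadInput reg_c reg_pos;
  ReadMem reg_first reg_c;
  Rank reg_num reg_c reg_n].

Definition prepend_symbol : command := Block [::
  Move reg_a reg_c;
  Op Defs.Sub reg_pos reg_pos reg_one;
  ReadInput reg_c reg_pos;
  Op Add reg_last reg_first reg_num;
  Rank reg_lo reg_c reg_first;
  Rank reg_hi reg_c reg_last;
  Op Defs.Sub reg_num reg_hi reg_lo;
  Op Mul reg_addr reg_c reg_sigma;
  Op Add reg_addr reg_addr reg_sigma;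
  Op Add reg_addr reg_addr reg_a;
  ReadMem reg_first reg_addr;
  Op Add reg_first reg_first reg_lo].

Definition return_empty : command :=
  Block [:: Const out_start 0; Const out_num 0].

Definition return_range : command := IfLt reg_zero reg_num
  (Block [:: Op Add out_start reg_first reg_one; Move out_num reg_num])
  return_empty.

Definition search_backward : command := (
  load_last_symbol;;
  WhileLt reg_zero reg_pos prepend_symbol;;
  return_range)%C.

Definition query_command : command :=
  IfLt reg_n reg_size
    return_empty
    (IfLt reg_zero reg_size
       search_backward
       (Block [:: Move out_num reg_n; Const out_start 1])).

Local Notation triple := (triple w (code x) (rank L)).

Definition query_pre : assertion := fun r m t =>
  [/\ r = nth 0 [:: n; sigma; size x], tables_stored m
    & t <= table_size].

Definition query_post : assertion := fun r m t =>
  [/\ r out_start = range_start pi s x, r out_num = num_rows x, tables_stored m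
    & t <= table_size].

Definition suffix_inv k : assertion := fun r m t =>
  let i := (size x).-1 - k in
  [/\ [/\ r reg_n = n, r reg_sigma = sigma, r reg_one = 1 & r reg_zero = 0],
      [/\ r reg_pos = i, r reg_c = nth d x i, r reg_first = first_row (drop i x)
        & r reg_num = num_rows (drop i x)],
      tables_stored m & t <= table_size].

Lemma nth_code i : i < size x -> nth 0 (code x) i = nth d x i.
Proof. by move=> lt_i; rewrite (nth_map d). Qed.

Lemma return_empty_correct :
  triple
    (fun _ m t => [/\ num_rows x = 0, tables_stored m & t <= table_size])
    return_empty 2 query_post.
Proof.
apply: triple_block => // r m t [num0 tables le_t].
by rewrite /holds /query_post /range_start /= num0 wrap_small ?expn_gt0.
Qed.

Lemma return_range_correct :
  triple (suffix_inv (size x).-1) return_range 4 query_post.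
Proof.
apply: triple_if.
  apply: triple_block => // r m t []; rewrite /suffix_inv subnn drop0.
  move=> [[_ _ rone rzero] [_ _ rfirst rnum] tables le_t].
  rewrite rzero rnum => num_gt0; rewrite /holds /query_post /= rfirst rnum rone.
  rewrite /range_start gtn_eqF // add_small addn1 //.
  by have := range_word x; lia.
apply: triple_weaken return_empty_correct _ _ (leqnn _) => // r m t [].
rewrite /suffix_inv subnn drop0 => -[[_ _ _ rzero] [_ _ _ rnum] tables le_t].
by rewrite rzero rnum leqn0 => /eqP.
Qed.

Lemma load_last_symbol_correct : 0 < size x ->
  triple query_pre load_last_symbol 5 (suffix_inv 0).
Proof.
move=> x_gt0; apply: triple_block => // r m t [-> tables le_t].
have [singles _] := tables; have lt_i : (size x).-1 < size x by rewrite prednK.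
rewrite /holds /suffix_inv subn0 /= (wrap_small one_word) sub_small ?x_gt0 //.
rewrite subn1 nth_code // (drop_nth d) // prednK // drop_size.
rewrite singles ?mem_enum // rankE -(num_rows_symbol pi_total) //.
by split=> //; rewrite geq_max le_t symbol_address_lt.
Qed.

Lemma prepend_symbol_correct k : size x <= n -> k < (size x).-1 ->
  triple (suffix_inv k) prepend_symbol 12 (suffix_inv k.+1).
Proof.
move=> le_xn lt_k; apply: triple_block => // r m t.
rewrite /holds /suffix_inv /=; set i := (size x).-1 - k.+1.
have -> : (size x).-1 - k = i.+1 by rewrite /i; lia.
have lt_i1 : i.+1 < size x by rewrite /i; lia.
have lt_i := ltnW lt_i1.
move=> [[rn rsigma rone rzero] [rpos rc rfirst rnum] tables le_t].
have [_ pairs] := tables.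
rewrite rn rsigma rone rpos rc rfirst rnum.
have -> : sub i.+1 1 = i by rewrite sub_small ?subn1 //; lia.
rewrite nth_code // (drop_nth d lt_i).
set c := nth d x i; set a := nth d x i.+1.
have lt_dropn : size (drop i.+1 x) < n by rewrite size_drop; lia.
have addrE : add (add (eval_op w Mul c sigma) sigma) a = pair_address c a.
  have := pair_address_lt c a; rewrite /pair_address mulnS => lt_addr.
  by rewrite mul_small ?add_small 1?mulnC ?[_ + sigma]addnC //; lia.
rewrite addrE pairs ?ltn_ord //; last by lia.
rewrite sub_rank_range // [X in first_row X](drop_nth d lt_i1) add_offset.
  rewrite -(drop_nth d lt_i1); split=> //.
  by rewrite geq_max le_t pair_address_lt.
by rewrite size_drop; lia.
Qed.

Lemma search_backward_correct : 0 < size x <= n ->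
  triple query_pre search_backward (14 * size x) query_post.
Proof.
move=> /andP[x_gt0 le_xn].
apply: (triple_leq (k := 5 + ((size x).-1 * 14 + 2 + 4))); last lia.
apply: triple_then (load_last_symbol_correct x_gt0) _.
apply: triple_then return_range_correct.
apply: triple_while => [k r m t le_k [[_ _ _ ->] [-> _ _ _] _ _]|k].
  by rewrite subn_gt0.
exact: prepend_symbol_correct.
Qed.

Lemma query_correct :
  triple query_pre query_command (18 * maxn 1 (size x)) query_post.
Proof.
apply: (triple_leq (k := (14 * maxn 1 (size x)).+4)); last lia.
apply: triple_if.
  apply: triple_weaken return_empty_correct _ _ _ => //.
  move=> r m t [[-> tables le_t]] lt_nx; split=> //.
  by apply/eqP; apply: contraLR lt_nx => /size_num_rows_neq0; rewrite -leqNgt.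
apply: triple_if.
  apply: (triple_fact (fact := 0 < size x <= n)) => [r m t|x_size].
    by move=> [[[-> _ _] /= le_xn] x_gt0]; apply/andP.
  apply: triple_weaken (search_backward_correct x_size) _ _ _ => //.
    by move=> r m t [[]].
  by rewrite leq_mul2l leq_maxr.
apply: (triple_leq (k := 2)); last lia.
apply: triple_block => // r m t [[[-> tables le_t] _]] /=.
rewrite leqn0 => /nilP x0; rewrite /holds /query_post /= (wrap_small one_word).
by rewrite x0 /range_start num_rows_nil first_row_nil gtn_eqF.
Qed.

End Query.

Lemma answers_correct t m xs : t <= table_size -> tables_stored m ->
  (forall x, x \in xs -> size x < 2 ^ w) ->
  answers w n (Mstar pi s) L (compile 0 query_command) 35 t m xs.
Proof.
move=> le_t; elim: xs m => //= x xs IH m tables xs_word.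
have x_word : size x < 2 ^ w by apply: xs_word; rewrite mem_head.
have [halt [start_x num_x tables' le_t']] :
    let cf := run w (code x) (rank L) (compile 0 query_command)
      (35 * maxn 1 (size x)) (start [:: n; sigma; size x] m t) in
    halted (compile 0 query_command) cf /\ holds (query_post x) cf.
  exact: triple_run (query_correct x_word) (leq_mul _ (leqnn _)) _.
split=> //.
- by rewrite start_x num_x; apply: is_range_num_rows.
- by have := sigma_gt0; nia.
- by apply: IH => // y y_xs; apply: xs_word; rewrite inE y_xs orbT.
Qed.

End Correctness.

Theorem theorem19 :
  exists (preprocess query : program) (C : nat),
  forall K : nat, exists w0 : nat,
  forall (w sigma n : nat) (s : n.-tuple 'I_sigma)
         (pi : seq 'I_sigma -> rel 'I_sigma)
         (pi_eps : rel 'I_sigma) (pi_sym : 'I_sigma -> rel 'I_sigma),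
    w0 <= w -> sigma <= w ^ K -> n < 2 ^ w ->
    primitive_string s ->
    (forall y, total_order (pi y)) ->
    local_ordering pi pi_eps pi_sym ->
    let M := Mstar pi s in
    let L := BWTstar pi s in
    let cf := run w (order_table pi_eps pi_sym) (rank L) preprocess
                (C * sigma ^ 2) (start [:: n; sigma] (fun=> 0) 0) in
    [/\ halted preprocess cf,
        top cf <= C * sigma ^ 2 &
        forall xs : seq (seq 'I_sigma),
          (forall x, x \in xs -> size x < 2 ^ w) ->
          answers w n M L query C (top cf) (memory cf) xs].
Proof.
exists (compile 0 preprocess_command), (compile 0 query_command), 35 => K.
have [w0 sigma_word] := sqr_add_lt_exp2 K; exists w0.
move=> w sigma n s pi pi_eps pi_sym le_w le_sigma n_word /andP[s_gt0 _].
move=> pi_total pi_local M L cf; have d : 'I_sigma by case: (tval s) s_gt0.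
have {}sigma_word := sigma_word _ _ le_w le_sigma.
rewrite -(size_tuple s) in n_word cf *.
have [halt [tables le_t]] : halted (compile 0 preprocess_command) cf /\
    holds (fun _ m t => tables_stored w s pi m /\ t <= sigma ^ 2 + sigma) cf.
  have correct := preprocess_correct d pi_total pi_local s_gt0 n_word.
  exact: triple_run (correct sigma_word) (leqnn _) _.
split=> // [|xs].
  by apply: leq_trans le_t _; have := sigma_gt0 d; nia.
exact: (answers_correct d pi_total pi_local).
Qed.
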